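(* The function $\sigma_k:\Omega_k\to\Omega$ is a covering map of degree $k^2$.
   Context: Here $k$ is a positive integer. Points of $\mathbb{C}^4$ are written $z=(z_0,\underline{z})$ with $\underline{z}=(z_1,z_2,z_3)$, and $\underline{z}^2:=z_1^2+z_2^2+z_3^2\in\mathbb{C}$. The polynomials $p_0^k$ and $p_1^{k-1}$ in two variables are determined by $(x+\imath y)^k=p_0^k(x,y^2)+\imath\, y\,p_1^{k-1}(x,y^2)$ for $x,y\in\mathbb{R}$. The map $\sigma_k:\mathbb{C}^4\to\mathbb{C}^4$ is $$\sigma_k(z_0,\underline{z})=\big(p_0^k(z_0,\underline{z}^2),\ p_1^{k-1}(z_0,\underline{z}^2)\,\underline{z}\big);$$ it is the $k$-th power map of the algebra $\mathbb{C}\otimes_{\mathbb{R}}\mathbb{H}\cong\mathbb{C}^4$ ($\mathbb{H}$ the quaternions), with basis $1\otimes1,1\otimes i,1\otimes j,1\otimes k$. Put $$\Omega'_k=\{(z_0,\underline{z})\in\mathbb{C}^4:\ \underline{z}^2\neq0,\ p_1^{k-1}(z_0,\underline{z}^2)\neq0\},$$ $$\Omega=\{(z_0,\underline{z})\in\mathbb{C}^4:\ \underline{z}^2\ne0,\ z_0^2+\underline{z}^2\neq0,\ z_0\neq0\},\qquad \Omega_k=\Omega'_k\cap\Omega.$$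
   Formalization: The domain is Ω_k ∩ σ_k^{-1}(Ω) instead of Ω_k: for k ≥ 2, σ_k does not map all of Ω_k into Ω, since p_0^k may vanish there (k = 2, z = (1,1,0,0) gives p_0 = 0). The target Ω and the degree k² are unchanged. *)

(* Defs.v *)
From HB Require Import structures.
From mathcomp Require Import all_boot all_order all_algebra.
From mathcomp Require Import complex ring.
From mathcomp Require Import all_classical all_reals all_analysis.

Set Implicit Arguments.
Unset Strict Implicit.
Unset Printing Implicit Defensive.

Import Order.TTheory GRing.Theory Num.Theory numFieldNormedType.Exports.

Local Open Scope classical_set_scope.
Local Open Scope complex_scope.
Local Open Scope ring_scope.

(** Covering maps between subsets of topological spaces. Every notion refers
    to the subspace topologies of the subsets involved. *)

Definition homeomorphism_on (X Y : topologicalType) (V : set X) (U : set Y)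
    (f : X -> Y) : Prop :=
  [/\ set_bij V U f,
      {within V, continuous f} &
      exists g : Y -> X,
        [/\ set_fun U V g, {in V, cancel f g}, {in U, cancel g f} &
            {within U, continuous g}]].

Definition evenly_covered (X Y : topologicalType) (A : set X) (f : X -> Y)
    (d : nat) (U : set Y) : Prop :=
  exists V : 'I_d -> set X,
    [/\ forall i, V i `<=` A /\ open (V i : set (subspace A)),
        trivIset setT V,
        A `&` f @^-1` U = \bigcup_i V i &
        forall i, homeomorphism_on (V i) U f].

Definition covering_map (X Y : topologicalType) (A : set X) (B : set Y)
    (f : X -> Y) (d : nat) : Prop :=
  [/\ set_fun A B f,
      {within A, continuous f} &
      forall b, B b -> exists U : set Y,
        [/\ U b, U `<=` B, open (U : set (subspace B)) &
            evenly_covered A f d U]].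

(** Two-variable polynomials are polynomials in the first variable [x] over the
    polynomials in the second one. *)
Definition eval2 (K : comNzRingType) (p : {poly {poly K}}) (x t : K) : K :=
  p.[x%:P].[t].

Definition power_polys (R : realType) (k : nat) (p q : {poly {poly R[i]}}) :
    Prop :=
  forall x y : R,
    (x%:C + 'i * y%:C) ^+ k =
      eval2 p x%:C (y ^+ 2)%:C + 'i * y%:C * eval2 q x%:C (y ^+ 2)%:C.

(** The complex field enters as an abstract [C : numClosedFieldType], because
    this is the structure from which [R[i]] gets its normed topology. The points
    of [C^4] are the pairs [(z_0, (z_1, z_2, z_3))]. *)
Definition C4 (C : numClosedFieldType) : normedModType C :=
  (C * 'rV[C]_3)%type.

Section Sigma.
Variable C : numClosedFieldType.
Implicit Types (p q : {poly {poly C}}) (z : C4 C).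

(** Not a norm: no complex conjugation is involved. *)
Definition vsqr (v : 'rV[C]_3) : C := \sum_(i < 3) v 0 i ^+ 2.

Definition sigma p q z : C4 C :=
  (eval2 p z.1 (vsqr z.2), eval2 q z.1 (vsqr z.2) *: z.2).

Definition Omega : set (C4 C) :=
  [set z | [/\ vsqr z.2 != 0, z.1 ^+ 2 + vsqr z.2 != 0 & z.1 != 0]].

Definition Omega' q : set (C4 C) :=
  [set z | vsqr z.2 != 0 /\ eval2 q z.1 (vsqr z.2) != 0].

Definition Omega_k q : set (C4 C) := Omega' q `&` Omega.

End Sigma.

Arguments Omega : clear implicits.

Fact eval2_0 (K : comNzRingType) (x t : K) : eval2 0 x t = 0.
Proof. by rewrite /eval2 !hornerE. Qed.

Fact eval2_1 (K : comNzRingType) (x t : K) : eval2 1 x t = 1.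
Proof. by rewrite /eval2 !hornerE. Qed.

Fact eval2_re (K : comNzRingType) (p q : {poly {poly K}}) (x t : K) :
  eval2 ('X * p - ('X)%:P * q) x t = x * eval2 p x t - t * eval2 q x t.
Proof. by rewrite /eval2 !hornerE. Qed.

Fact eval2_im (K : comNzRingType) (p q : {poly {poly K}}) (x t : K) :
  eval2 (p + 'X * q) x t = eval2 p x t + x * eval2 q x t.
Proof. by rewrite /eval2 !hornerE. Qed.

Fact power_step (K : comNzRingType) (i x y a b : K) : i ^+ 2 = -1 ->
  (x + i * y) * (a + i * y * b) =
    x * a - y ^+ 2 * b + i * y * (a + x * b).
Proof. by move=> i2; ring: i2. Qed.

Fact power2_parts (K : numClosedFieldType) (a b : K) :
  (1 + 'i * 1) ^+ 2 = a + 'i * 1 * b ->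
  (1 + 'i * (-1)) ^+ 2 = a + 'i * (-1) * b -> a = 0 /\ b = 2%:R.
Proof.
have i2 := sqrCi K => H1 H2.
have a0 : a = 0.
  apply: (mulfI (_ : 2%:R != 0 :> K)); first by rewrite pnatr_eq0.
  transitivity ((a + 'i * 1 * b) + (a + 'i * (-1) * b)); first by ring.
  by rewrite -H1 -H2; ring: i2.
split=> //; apply: (mulfI (neq0Ci K)).
transitivity (a + 'i * 1 * b); first by rewrite a0; ring.
by rewrite -H1; ring: i2.
Qed.

Fact power_parts_exist (K : numClosedFieldType) k :
  exists p q : {poly {poly K}}, forall x y : K,
    (x + 'i * y) ^+ k =
      eval2 p x (y ^+ 2) + 'i * y * eval2 q x (y ^+ 2).
Proof.
elim: k => [|k [p [q IH]]].
  by exists 1, 0 => x y; rewrite expr0 eval2_1 eval2_0 mulr0 addr0.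
exists ('X * p - ('X)%:P * q), (p + 'X * q) => x y.
by rewrite exprS IH eval2_re eval2_im; apply: power_step; exact: sqrCi.
Qed.

Lemma power_polys_exist (R : realType) k :
  exists p q : {poly {poly R[i]}}, power_polys k p q.
Proof.
have [p [q pqP]] := power_parts_exist R[i] k.
exists p, q => x y.
have -> : (y ^+ 2)%:C = y%:C ^+ 2 by exact: rmorphXn.
exact: pqP.
Qed.

(** [sigma] does not map all of [Omega_k] into [Omega], because [p] may vanish
    at points of [Omega_k]: hence a covering map of [Omega] has to be taken on
    the part of [Omega_k] which lies over [Omega]. *)
Fact sigma_not_into_Omega (C : numClosedFieldType) (p q : {poly {poly C}}) :
  eval2 p 1 1 = 0 -> eval2 q 1 1 = 2%:R ->
  ~ set_fun (Omega_k q) (Omega C) (sigma p q).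
Proof.
move=> p0 q0 fOk.
pose z : C4 C := (1, \row_j (j == 0)%:R).
have vz : vsqr z.2 = 1.
  rewrite /vsqr big_ord_recl big1 ?addr0 ?mxE ?expr1n// => i _.
  by rewrite mxE expr0n.
have : Omega_k q z.
  rewrite /Omega_k /Omega' /Omega /= vz; split; split;
    by rewrite ?q0 ?expr1n ?oner_eq0 ?pnatr_eq0.
by move=> /fOk[_ _ /=]; rewrite vz p0 eqxx.
Qed.

Lemma sigma2_not_into_Omega (R : realType) (p q : {poly {poly R[i]}}) :
  power_polys 2 p q -> ~ set_fun (Omega_k q) (Omega R[i]) (sigma p q).
Proof.
move=> H; have [p0 q0] : eval2 p 1 1 = 0 /\ eval2 q 1 1 = 2%:R.
  apply: (@power2_parts R[i]).
    by have := H 1 1; rewrite expr1n.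
  have := H 1 (-1); rewrite sqrrN expr1n.
  by have -> : (-1)%:C = -1 :> R[i] by exact: rmorphN1.
exact: sigma_not_into_Omega.
Qed.

(* Main.v *)
Require Import Defs.
From mathcomp Require Import all_boot all_order all_algebra.
From mathcomp Require Import separable cyclotomic.
From mathcomp Require Import complex ring.
From mathcomp Require Import all_classical all_reals all_analysis.

Import Order.TTheory GRing.Theory Num.Theory numFieldNormedType.Exports.

Set Implicit Arguments.
Unset Strict Implicit.
Unset Printing Implicit Defensive.

Local Open Scope classical_set_scope.
Local Open Scope complex_scope.
Local Open Scope ring_scope.

(** Over the complex numbers write [z.2 ^ 2] for [vsqr z.2], choose [s] with
    [s ^+ 2 = z.2 ^ 2], and put [a = z.1 + 'i * s], [b = z.1 - 'i * s]. These are
    the two eigenvalues of [z] in the complexified quaternions, and the identity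
    [(x + 'i y) ^+ k = p x y^2 + 'i y q x y^2], which extends from real to
    complex [x] and [y] ([power_polys_complex]), says that [sigma] replaces
    [(a, b)] by [(a ^+ k, b ^+ k)] while keeping the direction of [z.2]
    ([eval_parts]). The conditions defining [Omega] read [a != b], [a * b != 0]
    and [a != - b]. Each of [a = b] and [a = - b] forces [a ^+ k = b ^+ k] or
    [a ^+ k = - b ^+ k], and [a * b = 0] forces [a ^+ k * b ^+ k = 0], so the part
    of [Omega_k] lying over [Omega] is the whole preimage of [Omega]
    ([Omega_lift]).

    Hence a point of the fibre over [w] amounts to a [k]-th root [a] of
    [w.1 + 'i * s] and a [k]-th root [b] of [w.1 - 'i * s], where now
    [s ^+ 2 = w.2 ^ 2]; the point is recovered as
    [((a + b) / 2, ((a - b) / (2 'i s)) *: w.2)] ([fibre_point] and the three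
    lemmas about it). This gives [k * k] points.

    Near a given point of [Omega], [s] and the two [k]-th roots can be chosen
    continuously, because the power map is open and, away from [0], locally
    injective ([root_branch]). Multiplying the two roots by all pairs of [k]-th
    roots of unity gives [k ^ 2] continuous local sections of [sigma], disjoint
    and exhausting the fibres; such a family trivializes the map
    ([evenly_covered_sections]). *)

(** * Trivialization by sections *)

(** The sheet of [g i] is [{x | g i (f x) = x}], a closed condition in a
    Hausdorff space. Finitely many disjoint closed sheets which fill the preimage
    of [U] are also open: near a point of one sheet, the conditions of all the
    others fail, so that only the former can hold. *)
Lemma evenly_covered_sections (X Y : topologicalType) (I : finType)
    (A : set X) (f : X -> Y) (U : set Y) (g : I -> Y -> X) :
  hausdorff_space X -> open A -> continuous f -> open U ->
  (forall i, {in U, continuous (g i)}) ->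
  (forall i, {in U, cancel (g i) f}) ->
  (forall i u, U u -> A (g i u)) ->
  (forall u, U u -> injective (g^~ u)) ->
  (forall x, A x -> U (f x) -> exists i, g i (f x) = x) ->
  evenly_covered A f #|I| U.
Proof.
rewrite open_hausdorff => hX oA cf oU cg gK gA ginj gsurj.
pose V i : set X := [set x | [/\ A x, U (f x) & g i (f x) = x]].
have inU u : U u -> u \in U by move=> Uu; exact/mem_set.
have VgU i u : U u -> V i (g i u).
  by move=> Uu; split; rewrite ?gK ?inU//; exact: gA.
have oV i : open (V i).
  rewrite openE => x [Ax Ufx gx].
  (* A point off the closed sheet of each [j != i] has a neighbourhood off it. *)
  have others : \forall y \near x, forall j, j != i -> g j (f y) <> y.
    apply: filter_forall => j; have [->|jNi] := eqVneq j i.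
      exact: nearW.
    have gjx : g j (f x) != x.
      by apply: contra_neq jNi => gjx; apply: (ginj _ Ufx); rewrite /= gjx.
    have [[P Q] /= [/set_mem Pgx /set_mem Qx] [oP oQ /eqP PQ]] := hX _ _ gjx.
    have nP : \forall y \near x, P (g j (f y)).
      apply: (continuous_comp (cf x) (cg j _ (inU _ Ufx))).
      exact: open_nbhs_nbhs.
    have nQ : \forall y \near x, Q y by exact: open_nbhs_nbhs.
    near=> y => _ gy.
    suff : (P `&` Q) y by rewrite PQ.
    by split; [rewrite -gy; near: y | near: y].
  have nA : \forall y \near x, A y by exact: open_nbhs_nbhs.
  have nU : \forall y \near x, U (f y) by apply: cf; exact: open_nbhs_nbhs.
  near=> y.
  have Ay : A y by near: y.
  have Ufy : U (f y) by near: y.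
  have [j gy] := gsurj _ Ay Ufy.
  have jP : forall j, j != i -> g j (f y) <> y by near: y.
  by split=> //; have [<-//|/jP] := eqVneq j i.
exists (fun i => V (enum_val i)); split.
- by move=> i; split; [move=> x [] | exact: open_subspaceW].
- move=> i j _ _ [x [[_ Ux gi] [_ _ gj]]]; apply: enum_val_inj.
  by apply: (ginj _ Ux); rewrite /= gi gj.
- rewrite eqEsubset; split=> [x [Ax Ux]|x [i _ [Ax Ux _]]]; last by [].
  have [i gx] := gsurj _ Ax Ux.
  by exists (enum_rank i) => //=; rewrite enum_rankK.
- move=> j; set i := enum_val j; split.
  + split; first by move=> x [].
      by move=> x y /set_mem[_ _ gx] /set_mem[_ _ gy] fxy; rewrite -gx -gy fxy.
    by move=> u Uu; exists (g i u); [exact: VgU | rewrite gK ?inU].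
  + exact: continuous_subspaceT.
  + exists (g i); split.
    * by move=> u; exact: VgU.
    * by move=> x /set_mem[].
    * exact: gK.
    * exact: continuous_in_subspaceT.
Unshelve. all: by end_near. Qed.

(** * Continuity of [sigma] *)

Section Continuity.
Variables (C : numClosedFieldType) (T : topologicalType).
Implicit Types (f g : T -> C) (x : T).

Lemma cont_mul f g x : {for x, continuous f} -> {for x, continuous g} ->
  {for x, continuous (fun y => f y * g y)}.
Proof. by move=> cf cg; exact: (cvgM cf cg). Qed.

Lemma cont_add f g x : {for x, continuous f} -> {for x, continuous g} ->
  {for x, continuous (fun y => f y + g y)}.
Proof. by move=> cf cg; exact: (cvgD cf cg). Qed.

Lemma cont_cst (c : C) x : {for x, continuous (fun y : T => c)}.
Proof. exact: cvg_cst. Qed.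

Lemma cont_inv f x : f x != 0 -> {for x, continuous f} ->
  {for x, continuous (fun y => (f y)^-1)}.
Proof. by move=> fx cf; exact: (cvgV fx cf). Qed.

Lemma cont_exp f n x : {for x, continuous f} ->
  {for x, continuous (fun y => f y ^+ n)}.
Proof.
move=> cf; elim: n => [|n IH]; first exact: cont_cst.
have -> : (fun x => f x ^+ n.+1) = (fun x => f x * f x ^+ n).
  by apply/funext => y; rewrite exprS.
exact: cont_mul.
Qed.

Lemma cont_scale (V : normedModType C) f (v : T -> V) x :
   {for x, continuous f} -> {for x, continuous v} ->
  {for x, continuous (fun y => f y *: v y)}.
Proof. by move=> cf cg; exact: (cvgZ cf cg). Qed.

Lemma cont_neq0 f x : {for x, continuous f} -> f x != 0 ->
  \forall y \near x, f y != 0.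
Proof. by move=> cf fx; exact: (cvgr_neq0 _ cf). Qed.

Lemma cont_sum (I : Type) (r : seq I) (F : I -> T -> C) x :
  (forall i, {for x, continuous (F i)}) ->
  {for x, continuous (fun y => \sum_(i <- r) F i y)}.
Proof.
move=> cF; elim: r => [|i r IH].
  rewrite (_ : (fun y => _) = (fun=> 0)); first exact: cont_cst.
  by apply/funext => y; rewrite big_nil.
rewrite (_ : (fun y => _) = (fun y => F i y + \sum_(j <- r) F j y)).
  exact: cont_add.
by apply/funext => y; rewrite big_cons.
Qed.

End Continuity.

Lemma cont_pair (T U V: topologicalType) (f : T -> U) (g : T -> V) x :
  {for x, continuous f} -> {for x, continuous g} ->
  {for x, continuous (fun y => (f y, g y))}.
Proof. by move=> cf cg; exact: (cvg_pair cf cg). Qed.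

Lemma cont_fst C (x : C4 C) : {for x, continuous (fun y : C4 C => y.1 : C)}.
Proof. exact: cvg_fst. Qed.

Lemma cont_snd C (x : C4 C) : {for x, continuous (fun y : C4 C => y.2)}.
Proof. exact: cvg_snd. Qed.

Section C4continuity.
Variable C : numClosedFieldType.
Implicit Types (p : {poly {poly C}}) (z : C4 C).

Lemma cont_vsqr z : {for z, continuous (fun w : C4 C => vsqr w.2)}.
Proof.
apply: cont_sum => i; apply: cont_exp.
apply: (@continuous_comp _ _ _ (fun w : C4 C => w.2)
  (fun v : 'rV[C]_3 => v 0 i)).
  exact: cont_snd.
exact: coord_continuous.
Qed.

Lemma cont_eval2 (T : topologicalType) p (f g : T -> C) x :
  {for x, continuous f} -> {for x, continuous g} ->
  {for x, continuous (fun y => eval2 p (f y) (g y))}.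
Proof.
move=> cf cg.
have ch (q : {poly C}) : {for x, continuous (fun y => q.[g y])}.
  elim/poly_ind: q => [|q c IH].
    rewrite (_ : (fun y => _) = (fun=> 0)); first exact: cont_cst.
    by apply/funext => y; rewrite horner0.
  rewrite (_ : (fun y => _) = (fun y => q.[g y] * g y + c)).
    by apply: cont_add; [exact: cont_mul|exact: cont_cst].
  by apply/funext => y; rewrite !hornerE.
elim/poly_ind: p => [|q c IH].
  rewrite (_ : (fun y => _) = (fun=> 0)); first exact: cont_cst.
  by apply/funext => y; rewrite eval2_0.
rewrite (_ : (fun y => _) = (fun y => eval2 q (f y) (g y) * f y + c.[g y])).
  by apply: cont_add => //; exact: cont_mul.
by apply/funext => y; rewrite /eval2 !hornerE.
Qed.

Lemma cont_sigma p q : continuous (sigma p q).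
Proof.
move=> z; apply: (@cont_pair (C4 C) C 'rV[C]_3).
  by apply: cont_eval2; [exact: cont_fst | exact: cont_vsqr].
apply: cont_scale; last exact: cont_snd.
by apply: cont_eval2; [exact: cont_fst | exact: cont_vsqr].
Qed.

Lemma open_Omega : open (Omega C).
Proof.
rewrite openE => z [h1 h2 h3].
have c1 := cont_neq0 (@cont_vsqr z) h1.
have c2 : \forall w \near z, w.1 ^+ 2 + vsqr w.2 != 0.
  apply: (@cont_neq0 C (C4 C) (fun w => w.1 ^+ 2 + vsqr w.2)) => //.
  apply: cont_add; last exact: cont_vsqr.
  by apply: cont_exp; exact: cont_fst.
have c3 := cont_neq0 (@cont_fst C z) h3.
by near=> w; split; near: w.
Unshelve. all: by end_near. Qed.

End C4continuity.

(** * Continuous roots *)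

Section Roots.
Variable C : numClosedFieldType.
Implicit Types (a x y : C) (n : nat).

Lemma split_XnsubC n x : (0 < n)%N ->
  exists2 rs : seq C, size rs = n &
    'X^n - x%:P = \prod_(z <- rs) ('X - z%:P).
Proof.
move=> n0; have [rs] := closed_field_poly_normal ('X^n - x%:P : {poly C}).
rewrite (monicP (monicXnsubC _ n0)) scale1r => rsE; exists rs => //.
by apply: succn_inj; rewrite -(size_prod_XsubC _ id) -rsE size_XnsubC.
Qed.

(** If [z ^+ n - x] factors as the product of the [z - y] over the [n]-th roots
    [y] of [x], then at [z = a] one of the factors has modulus less than [e] as
    soon as [a ^+ n - x] has modulus less than [e ^+ n]: some root of [x] is
    close to [a]. *)
Lemma exp_open n a (W : set C) : (0 < n)%N -> nbhs a W ->
  \forall x \near a ^+ n, exists2 y, W y & y ^+ n = x.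
Proof.
move=> n0 /nbhs_ballP[e /= e0 aeW].
have: \forall x \near a ^+ n, `|a ^+ n - x| < e ^+ n.
  by apply/nbhs_ballP; exists (e ^+ n) => //=; exact: exprn_gt0.
apply: filterS => x xlt.
have [rs szrs rsE] := split_XnsubC x n0.
have E z : z ^+ n - x = \prod_(y <- rs) (z - y).
  have := congr1 (horner^~ z) rsE; rewrite !hornerE horner_prod /= => ->.
  by apply: eq_bigr => y _; rewrite !hornerE.
have [/hasP[y yrs ay]|/hasPn far] := boolP (has (fun y => `|a - y| < e) rs).
  exists y; first exact: aeW.
  by apply/eqP; rewrite -subr_eq0 E (big_rem _ yrs) /= subrr mul0r.
exfalso; move: xlt; rewrite E normr_prod => /lt_geF/negP; apply.
have -> : e ^+ n = \prod_(y <- rs) e.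
  by rewrite big_const_seq count_predT szrs iter_mulr_1.
rewrite big_seq [leRHS]big_seq.
apply: ler_prod => y yrs; rewrite ltW//=.
by rewrite real_leNgt ?far// ger0_real// ltW.
Qed.

(** The difference quotient [(x ^+ n - y ^+ n) / (x - y)] is a polynomial in
    [x] and [y] which takes the value [n a^(n-1) != 0] at [(a, a)], so it does not
    vanish near that point. *)
Lemma exp_inj_near n a : (0 < n)%N -> a != 0 ->
  exists W : set C, [/\ open W, W a &
    forall x y, W x -> W y -> x ^+ n = y ^+ n -> x = y].
Proof.
move=> n0 a0.
pose S (z : C * C) := \sum_(i < n) z.1 ^+ (n.-1 - i) * z.2 ^+ i.
have cS : {for (a, a), continuous S}.
  apply: cont_sum => i; apply: cont_mul; apply: cont_exp.
    exact: cvg_fst.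
  exact: cvg_snd.
have Sa : S (a, a) != 0.
  rewrite /S (eq_bigr (fun=> a ^+ n.-1)) => [|i _].
    by rewrite sumr_const card_ord mulrn_eq0 negb_or -lt0n n0 expf_neq0.
  by rewrite -exprD subnK// -ltnS prednK.
have [[P Q] /= [Pa Qa] PQ] := cont_neq0 cS Sa.
exists (P `&` Q)°; split.
- exact: open_interior.
- by apply: filterI.
move=> x y /interior_subset[Px _] /interior_subset[_ Qy] /eqP.
rewrite -subr_eq0 subrXX mulf_eq0 subr_eq0 => /orP[/eqP//|].
by have /negPf /= -> := PQ (x, y) (conj Px Qy).
Qed.

(** The branch is the local inverse, near a chosen root [a] of [h b], of the power
    map: it is well defined since that map is locally injective, and continuous
    since it is open. *)
Lemma root_branch n (T : topologicalType) (h : T -> C) b : (0 < n)%N ->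
  h b != 0 -> (\forall w \near b, {for w, continuous h}) ->
  exists r : T -> C,
    \forall w \near b, r w ^+ n = h w /\ {for w, continuous r}.
Proof.
move=> n0 hb0 ch.
have [rs szrs rsE] := split_XnsubC (h b) n0.
have [a an] : exists a, a ^+ n = h b.
  case: rs szrs rsE => [/esym n_eq0|a rs _ rsE]; first by rewrite n_eq0 in n0.
  exists a; have := congr1 (horner^~ a) rsE.
  rewrite big_cons !hornerE subrr mul0r => /eqP.
  by rewrite subr_eq0 => /eqP.
have a0 : a != 0.
  by apply: contraNneq hb0 => a0; rewrite -an a0 expr0n -[n]prednK.
have [W [oW Wa Winj]] := exp_inj_near n0 a0.
pose r w := xget 0 [set y | W y /\ y ^+ n = h w].
have rP w y : W y -> y ^+ n = h w -> r w = y.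
  move=> Wy yn; rewrite /r; case: xgetP => [z _ [Wz zn]|/(_ y)[]//].
  by apply: Winj => //; rewrite zn.
exists r; near=> w.
have cw : {for w, continuous h} by near: w.
have [y Wy yn] : exists2 y, W y & y ^+ n = h w.
  near: w; apply: (nbhs_singleton ch [set x | exists2 y, W y & y ^+ n = x]).
  rewrite -an.
  by apply: exp_open => //; exact: open_nbhs_nbhs.
rewrite (rP _ _ Wy yn); split=> // N /= nN.
have nW : nbhs y (W `&` N).
  apply: filterI; first exact: open_nbhs_nbhs.
  by move: nN; rewrite (rP _ _ Wy yn).
have : nbhs w (h @^-1` [set x | exists2 t, (W `&` N) t & t ^+ n = x]).
  by apply: cw; rewrite -yn; exact: exp_open.
by apply: filterS => v [t [Wt Nt] tn]; rewrite /= (rP v t).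
Unshelve. all: by end_near. Qed.

Lemma roots_of_unity n : (0 < n)%N ->
  exists e : 'I_n -> C, [/\ injective e, forall i, e i ^+ n = 1 &
    forall x, x ^+ n = 1 -> exists i, x = e i].
Proof.
move=> n0; have [rs szrs rsE] := split_XnsubC 1 n0.
have urs : uniq rs.
  by rewrite -separable_prod_XsubC -rsE separable_Xn_sub_1// pnatr_eq0 -lt0n.
have rsP x : (x \in rs) = (x ^+ n == 1).
  by rewrite -root_prod_XsubC -rsE rootE !hornerE subr_eq0.
exists (fun i => rs`_i); split.
- move=> i j /eqP; rewrite nth_uniq ?szrs// => /eqP; exact: val_inj.
- by move=> i; apply/eqP; rewrite -rsP mem_nth ?szrs.
- move=> x /eqP; rewrite -rsP => xrs.
  have ix : (index x rs < n)%N by rewrite -szrs index_mem.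
  by exists (Ordinal ix); rewrite /= nth_index.
Qed.

End Roots.

(** * From the real to the complex identity *)

Lemma poly_nat_zero (K : numDomainType) (p : {poly K}) :
  (forall n, p.[n%:R] = 0) -> p = 0.
Proof.
move=> pz; apply/eqP; apply: contraT => p0.
have := @max_poly_roots K p [seq n%:R | n <- iota 0 (size p)] p0.
rewrite size_map size_iota ltnn => ->//.
- by apply/allP => _ /mapP[n _ ->]; rewrite rootE pz.
- by rewrite map_inj_uniq ?iota_uniq// => m n /eqP; rewrite eqr_nat => /eqP.
Qed.

Definition parts_identity (C : numClosedFieldType) k (p q : {poly {poly C}}) :=
  forall x y : C, (x + 'i * y) ^+ k =
    eval2 p x (y ^+ 2) + 'i * y * eval2 q x (y ^+ 2).

Lemma eval2_horner (C : comNzRingType) (p : {poly {poly C}}) x t :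
  eval2 p x t = (map_poly (horner_eval t) p).[x].
Proof.
rewrite /eval2; elim/poly_ind: p => [|p c IH].
  by rewrite rmorph0 !horner0.
by rewrite rmorphD rmorphM /= map_polyX map_polyC /= !hornerE IH.
Qed.

(** Both sides are polynomials in [x] and in [y] separately, and an identity of
    polynomials in one variable follows from its instances at the natural
    numbers. So [x] becomes complex while [y] is a natural number, then [y]. *)
Lemma power_polys_complex (R : realType) k (p q : {poly {poly R[i]}}) :
  power_polys k p q -> parts_identity k p q.
Proof.
move=> H.
have natC n : (n%:R)%:C = n%:R :> R[i] by rewrite rmorph_nat.
have sqC n : ((n%:R : R) ^+ 2)%:C = n%:R ^+ 2 :> R[i].
  by rewrite rmorphXn /= natC.
have Hx x n : (x + 'i * n%:R) ^+ k =
    eval2 p x (n%:R ^+ 2) + 'i * n%:R * eval2 q x (n%:R ^+ 2).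
  pose P := ('X + ('i * n%:R)%:P) ^+ k - map_poly (horner_eval (n%:R ^+ 2)) p
    - ('i * n%:R)%:P * map_poly (horner_eval (n%:R ^+ 2)) q : {poly R[i]}.
  have P0 : P = 0.
    apply: poly_nat_zero => m; rewrite /P !hornerE -!eval2_horner.
    have := H m%:R n%:R; rewrite !natC sqC => ->; ring.
  have := congr1 (horner^~ x) P0; rewrite /P !hornerE -!eval2_horner => /eqP.
  by rewrite -addrA -opprD subr_eq0 => /eqP.
move=> x y.
pose P := (x%:P + 'i%:P * 'X) ^+ k - (p.[x%:P] \Po 'X^2)
    - 'i%:P * 'X * (q.[x%:P] \Po 'X^2) : {poly R[i]}.
have P0 : P = 0.
  apply: poly_nat_zero => m; rewrite /P !(hornerE, horner_comp) Hx /eval2; ring.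
have := congr1 (horner^~ y) P0; rewrite /P !(hornerE, horner_comp) => /eqP.
by rewrite -addrA -opprD subr_eq0 => /eqP.
Qed.

(** * The fibres of [sigma] *)

Lemma vsqrZ (C : numClosedFieldType) (c : C) v :
  vsqr (c *: v) = c ^+ 2 * vsqr v.
Proof.
by rewrite /vsqr mulr_sumr; apply: eq_bigr => i _; rewrite mxE exprMn.
Qed.

Section Fibre.
Variables (C : numClosedFieldType) (k : nat) (p q : {poly {poly C}}).
Hypotheses (k_gt0 : (0 < k)%N) (pqP : parts_identity k p q).
Implicit Types (z w : C4 C) (s a b : C).

Let i2 := sqrCi C.
Let i0 := neq0Ci C.
Let two0 : 2%:R != 0 :> C. Proof. by rewrite pnatr_eq0. Qed.

Lemma eval_parts (x s a b : C) : a = x + 'i * s -> b = x - 'i * s ->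
  eval2 p x (s ^+ 2) = (a ^+ k + b ^+ k) / 2%:R /\
  s * eval2 q x (s ^+ 2) = (a ^+ k - b ^+ k) / (2%:R * 'i).
Proof.
move=> -> ->; have -> : x - 'i * s = x + 'i * (- s) by ring.
rewrite !pqP sqrrN; split; field; rewrite ?i0 //.
Qed.

(** The point [z] such that [z.2] is parallel to [w.2] and which has the
    eigenvalues [a] and [b], when [s] is a square root of [vsqr w.2]: the square
    root of [vsqr z.2] is then [(a - b) / (2 'i)]. *)
Definition fibre_point s a b w : C4 C :=
  ((a + b) / 2%:R, ((a - b) / (2%:R * 'i * s)) *: w.2).

Lemma sigma_fibre_point s a b w : s ^+ 2 = vsqr w.2 -> s != 0 ->
  a ^+ k = w.1 + 'i * s -> b ^+ k = w.1 - 'i * s ->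
  sigma p q (fibre_point s a b w) = w.
Proof.
move=> s2 s0 ak bk; pose t := (a - b) / (2%:R * 'i).
have vt : vsqr (fibre_point s a b w).2 = t ^+ 2.
  by rewrite /= vsqrZ -s2 /t; field; rewrite i0 s0.
have [Ep Eq] := @eval_parts ((a + b) / 2%:R) t a b
  ltac:(by rewrite /t; field; rewrite i0)
  ltac:(by rewrite /t; field; rewrite i0).
rewrite /sigma vt; case: w {s2} ak bk Ep Eq {vt} => w1 w2 /= ak bk Ep Eq.
congr pair; first by rewrite Ep ak bk; field.
rewrite scalerA (_ : _ * _ = 1) ?scale1r//.
transitivity (t * eval2 q ((a + b) / 2%:R) (t ^+ 2) / s).
  by rewrite /t; field; rewrite s0 i0.
by rewrite Eq ak bk; field; rewrite s0 i0.
Qed.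

(** The square root of [vsqr z.2] has to be [s / Q], with [Q] the factor by which
    [sigma] multiplies [z.2], so that the ordered pair of eigenvalues of [z] is
    sent to the one which the choice of [s] assigns to [sigma p q z]. *)
Lemma fibre_point_surj s z : s ^+ 2 = vsqr (sigma p q z).2 -> s != 0 ->
  exists a b, [/\ a ^+ k = (sigma p q z).1 + 'i * s,
    b ^+ k = (sigma p q z).1 - 'i * s & fibre_point s a b (sigma p q z) = z].
Proof.
case: z => x v; rewrite /sigma /=; set P := eval2 p _ _; set Q := eval2 q _ _.
rewrite vsqrZ => s2 s0.
have Q0 : Q != 0.
  apply: contraNneq s0 => Q0; move: s2; rewrite Q0 expr0n mul0r => /eqP.
  by rewrite expf_eq0.
pose t := s / Q.
have t2 : t ^+ 2 = vsqr v.
  by rewrite /t expr_div_n s2 mulrAC divff ?mul1r ?expf_neq0.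
exists (x + 'i * t), (x - 'i * t); split.
- by rewrite pqP t2 -/P -/Q /t; field.
- have -> : x - 'i * t = x + 'i * (- t) by ring.
  by rewrite pqP sqrrN t2 -/P -/Q /t; field.
- rewrite /fibre_point; congr pair; first by rewrite /=; field.
  rewrite /= scalerA (_ : _ * _ = 1) ?scale1r//.
  by rewrite /t; field; rewrite Q0 s0 i0.
Qed.

Lemma fibre_point_inj s a b a' b' w : s != 0 -> vsqr w.2 != 0 ->
  fibre_point s a b w = fibre_point s a' b' w -> a = a' /\ b = b'.
Proof.
move=> s0 w0 [/(mulIf (invr_neq0 two0)) D /eqP].
have w20 : w.2 != 0.
  by apply: contraNneq w0 => ->; rewrite -(scale0r 0) vsqrZ expr0n mul0r.
rewrite -subr_eq0 -scalerBl scaler_eq0 (negPf w20) orbF subr_eq0 => /eqP.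
move=> /mulIf; rewrite invr_eq0 !mulf_neq0// => /(_ isT) B.
have A : a = a'.
  apply: (mulIf two0); transitivity ((a + b) + (a - b)); first by ring.
  by rewrite D B; ring.
by split=> //; move: D; rewrite A => /addrI.
Qed.

(** If [z.1 ^+ 2 + vsqr z.2 = 0], an eigenvalue of [z] vanishes and so does its
    power. If [z.1 = 0], the eigenvalues are opposite, their powers are
    equal or opposite according to the parity of [k], and one of the
    coordinates of [sigma p q z] vanishes. *)
Lemma Omega_lift z : Omega C (sigma p q z) -> Omega_k q z.
Proof.
case: z => x v; rewrite /Omega_k /Omega' /Omega /sigma /=.
rewrite vsqrZ => -[].
rewrite mulf_eq0 expf_eq0 negb_or => /andP[/= Q0 v0] n0 P0.
pose s := sqrtC (vsqr v).
have s2 : s ^+ 2 = vsqr v by rewrite sqrtCK.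
have s0 : s != 0 by rewrite sqrtC_eq0.
have E1 := pqP x s; have E2 := pqP x (- s); rewrite sqrrN s2 in E1 E2.
split; split=> //.
  apply: contraNneq n0 => n0.
  rewrite (_ : _ + _ = ((x + 'i * s) * (x + 'i * - s)) ^+ k); last first.
    by rewrite exprMn E1 E2 -s2; ring: i2.
  rewrite (_ : _ * _ = x ^+ 2 + vsqr v); last by rewrite -s2; ring: i2.
  by rewrite n0 expr0n -[k]prednK.
apply/negP => /eqP x0; subst x; move: E1 E2.
rewrite !add0r mulrN exprNn => ->; rewrite -signr_odd.
case: (odd k); rewrite ?expr1 ?expr0 ?mul1r ?mulN1r => E.
  apply/negP: P0; rewrite negbK; apply/eqP/(mulIf two0).
  set P := eval2 p _ _ in E *; set Q := eval2 q _ _ in E *.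
  transitivity ((P + - ('i * s) * Q) + (P + 'i * s * Q)); first by ring.
  by rewrite -E; ring.
have /eqP : 2%:R * 'i * s * eval2 q 0 (vsqr v) = 0.
  set P := eval2 p _ _ in E *; set Q := eval2 q _ _ in E *.
  transitivity ((P + 'i * s * Q) - (P + - ('i * s) * Q)); first by ring.
  by rewrite -E; ring.
by apply/negP; rewrite !mulf_neq0.
Qed.

End Fibre.

(** * The covering *)

Lemma local_branches (C : numClosedFieldType) k (b : C4 C) : (0 < k)%N ->
  Omega C b -> exists s ra rb : C4 C -> C, \forall w \near b,
    [/\ s w ^+ 2 = vsqr w.2, ra w ^+ k = w.1 + 'i * s w,
        rb w ^+ k = w.1 - 'i * s w &
        [/\ {for w, continuous s}, {for w, continuous ra} &
            {for w, continuous rb}]].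
Proof.
move=> k0 [v0 n0 _].
have [s sP] : exists s : C4 C -> C,
    \forall w \near b, s w ^+ 2 = vsqr w.2 /\ {for w, continuous s}.
  apply: (@root_branch C 2 (C4 C) (fun w => vsqr w.2)) => //.
  by apply: (@nearW _ (nbhs (b : C4 C))) => w; exact: cont_vsqr.
have [sb _] := @nbhs_singleton (C4 C) b _ sP.
(* The product of the eigenvalues of [b] is [b.1 ^+ 2 + vsqr b.2]. *)
have ab0 : (b.1 + 'i * s b) * (b.1 - 'i * s b) != 0.
  rewrite (_ : _ * _ = b.1 ^+ 2 + vsqr b.2)// -sb; ring: (sqrCi C).
move: ab0; rewrite mulf_eq0 negb_or => /andP[a0 b0].
have [ra raP] : exists r : C4 C -> C, \forall w \near b,
    r w ^+ k = w.1 + 'i * s w /\ {for w, continuous r}.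
  apply: (root_branch (h := fun w => w.1 + 'i * s w)) => //.
  apply: filterS sP => w [_ cs]; apply: cont_add; first exact: cont_fst.
  by apply: cont_mul cs; exact: cont_cst.
have [rb rbP] : exists r : C4 C -> C, \forall w \near b,
    r w ^+ k = w.1 - 'i * s w /\ {for w, continuous r}.
  apply: (root_branch (h := fun w => w.1 - 'i * s w)) => //.
  apply: filterS sP => w [_ cs].
  have -> : (fun w => w.1 - 'i * s w) = (fun w => w.1 + (- 'i) * s w).
    by apply/funext => u; rewrite mulNr.
  apply: cont_add; first exact: cont_fst.
  by apply: cont_mul cs; exact: cont_cst.
exists s, ra, rb; near=> w.
have [? ?] : s w ^+ 2 = vsqr w.2 /\ {for w, continuous s} by near: w.
have [? ?] : ra w ^+ k = w.1 + 'i * s w /\ {for w, continuous ra} by near: w.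
have [? ?] : rb w ^+ k = w.1 - 'i * s w /\ {for w, continuous rb} by near: w.
by [].
Unshelve. all: by end_near. Qed.

Lemma cont_fibre_point (C : numClosedFieldType) (s a b : C4 C -> C) w :
  s w != 0 -> {for w, continuous s} -> {for w, continuous a} ->
  {for w, continuous b} ->
  {for w, continuous (fun u => fibre_point (s u) (a u) (b u) u)}.
Proof.
move=> s0 cs ca cb; apply: (@cont_pair (C4 C) C 'rV[C]_3).
  by apply: cont_mul; [exact: cont_add | exact: cont_cst].
have cN : {for w, continuous (fun u => - b u)}.
  rewrite (_ : (fun u => _) = (fun u => (-1) * b u)).
    by apply: cont_mul cb; exact: cont_cst.
  by apply/funext => u; rewrite mulN1r.
apply: cont_scale; last exact: cont_snd.
apply: cont_mul; first exact: cont_add.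
apply: cont_inv; first by rewrite !mulf_neq0 ?pnatr_eq0 ?neq0Ci.
by apply: cont_mul cs; exact: cont_cst.
Qed.

(** All the branches are chosen on one neighbourhood [U] of [b]; the fibre lemmas
    then apply at each point of [U]. *)
Theorem sigma_covering (C : numClosedFieldType) k (p q : {poly {poly C}}) :
  (0 < k)%N -> parts_identity k p q ->
  covering_map (Omega_k q `&` sigma p q @^-1` Omega C) (Omega C)
    (sigma p q) (k ^ 2)%N.
Proof.
move=> k0 pqP.
have AE : Omega_k q `&` sigma p q @^-1` Omega C = sigma p q @^-1` Omega C.
  by apply/setIidr => z; exact: (Omega_lift k0 pqP).
have oA : open (sigma p q @^-1` Omega C).
  by apply: open_comp; [move=> z _; exact: cont_sigma | exact: open_Omega].
rewrite AE; split=> //.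
  by apply: continuous_subspaceT; exact: cont_sigma.
move=> b Ob; have [s [ra [rb sP]]] := local_branches k0 Ob.
have [e [e_inj e1 eP]] := roots_of_unity C k0.
pose G := [set w : C4 C | [/\ s w ^+ 2 = vsqr w.2, ra w ^+ k = w.1 + 'i * s w,
  rb w ^+ k = w.1 - 'i * s w & [/\ {for w, continuous s},
  {for w, continuous ra} & {for w, continuous rb}]]].
pose U := G° `&` Omega C.
have oU : open U by apply: openI; [exact: open_interior | exact: open_Omega].
have UG w : U w -> G w by move=> [/interior_subset].
have UO w : U w -> Omega C w by move=> [].
have s0 w : U w -> s w != 0.
  move=> Uw; have [sw _ _ _] := UG _ Uw; have [v0 _ _] := UO _ Uw.
  by apply: contraNneq v0 => sw0; rewrite -sw sw0 expr0n.
(* One section for each pair of [k]-th roots of unity. *)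
pose g (ij : 'I_k * 'I_k) w :=
  fibre_point (s w) (e ij.1 * ra w) (e ij.2 * rb w) w.
have gK ij w : U w -> sigma p q (g ij w) = w.
  move=> Uw; have [sw raw rbw _] := UG _ Uw.
  by apply: (sigma_fibre_point pqP) => //; rewrite ?s0// exprMn e1 mul1r.
have root0 (r c : C) : c != 0 -> r ^+ k = c -> r != 0.
  by move=> c0 rc; apply: contraNneq c0 => r0; rewrite -rc r0 expr0n -[k]prednK.
have ab0 w : U w -> ra w != 0 /\ rb w != 0.
  move=> Uw; have [sw raw rbw _] := UG _ Uw; have [_ n0 _] := UO _ Uw.
  have : (w.1 + 'i * s w) * (w.1 - 'i * s w) != 0.
    by rewrite (_ : _ * _ = w.1 ^+ 2 + vsqr w.2)// -sw; ring: (sqrCi C).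
  rewrite mulf_eq0 negb_or => /andP[a0 b0].
  by split; [exact: root0 raw | exact: root0 rbw].
exists U; split=> //.
  exact: open_subspaceW.
rewrite (_ : (k ^ 2)%N = #|{: 'I_k * 'I_k}|); last first.
  by rewrite card_prod card_ord.
apply: (evenly_covered_sections (g := g)) => //.
- exact: cont_sigma.
- move=> ij w /set_mem Uw; have [_ _ _ [cs ca cb]] := UG _ Uw.
  apply: cont_fibre_point => //; first exact: s0.
    by apply: cont_mul ca; exact: cont_cst.
  by apply: cont_mul cb; exact: cont_cst.
- by move=> ij w /set_mem Uw; exact: gK.
- by move=> ij w Uw; rewrite /= gK//; exact: UO.
- move=> w Uw [i j] [i' j'] /= gij; have [a0 b0] := ab0 _ Uw.
  have [v0 _ _] := UO _ Uw.
  have [] := fibre_point_inj (s0 _ Uw) v0 gij.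
  by move=> /(mulIf a0)/e_inj /= <- /(mulIf b0)/e_inj /= <-.
- move=> z _ Uz; have [sz raz rbz _] := UG _ Uz; have [a0 b0] := ab0 _ Uz.
  have [a [c [ak ck zE]]] := fibre_point_surj pqP sz (s0 _ Uz).
  have [i iE] : exists i, a / ra (sigma p q z) = e i.
    by apply: eP; rewrite expr_div_n ak raz divff// -raz expf_neq0.
  have [j jE] : exists j, c / rb (sigma p q z) = e j.
    by apply: eP; rewrite expr_div_n ck rbz divff// -rbz expf_neq0.
  by exists (i, j); rewrite /g /= -iE -jE !divfK.
Qed.

Unset Implicit Arguments.

Theorem theorem4p4 (R : realType) (k : nat) (k_gt0 : (0 < k)%N)
    (p0 p1 : {poly {poly R[i]}}) (p0p1P : power_polys k p0 p1) :
  covering_map (Omega_k p1 `&` sigma p0 p1 @^-1` Omega R[i]) (Omega R[i])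
    (sigma p0 p1) (k ^ 2)%N.
Proof. exact: sigma_covering (power_polys_complex p0p1P). Qed.
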